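(* Let $r_\nu(u)=I_\nu'(u)/I_\nu(u)$ for $\nu\ge0$, $u>0$. The inequality $$1+\frac{\nu^2-\frac12}{u^2}-\frac{r_\nu(u)}{u}-r_\nu(u)^2<0$$ does not hold for every $\nu\ge0$ and $u>0$: it fails at $(\nu,u)=(0,10)$.
   Context: $I_\nu$ is the modified Bessel function of the first kind of order $\nu$: for $u>0$, $I_\nu(u)=\sum_{k\ge0}\frac{(u/2)^{2k+\nu}}{k!\,\Gamma(k+\nu+1)}$; the prime denotes the derivative in $u$. *)

(* Defs.v *)
From Stdlib Require Import Factorial Reals.
From Coquelicot Require Import Coquelicot.

Open Scope R_scope.

(* Euler's integral; it converges exactly for x > 0, the only range where Gamma
   is used below. *)
Definition Gamma (x : R) : R :=
  RInt_gen (fun t => Rpower t (x - 1) * exp (- t))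
           (at_right 0) (Rbar_locally p_infty).

(* [Rpower] is the real power only for a positive base: [BesselI nu u] is
   meaningful for u > 0. *)
Definition BesselI (nu u : R) : R :=
  Series (fun k : nat =>
    Rpower (u / 2) (2 * INR k + nu) / (INR (fact k) * Gamma (INR k + nu + 1))).

Definition bessel_ratio (nu u : R) : R :=
  Derive (BesselI nu) u / BesselI nu u.

(* Main.v *)
Require Import Defs.
From Stdlib Require Import Factorial Reals Lra Lia.
From Coquelicot Require Import Coquelicot.
Open Scope R_scope.

(** Numerically [I_0'(10) / I_0(10)] is about [0.94860], while the left-hand side
    at [(0, 10)], [0.995 - r / 10 - r ^ 2], changes sign only at [r] about
    [0.94875].  It is therefore enough to prove [0 <= r <= 0.9487].

    Since [Gamma (k + 1) = k!] ([Gamma_INR_succ]), the function [I_0] is the entire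
    power series [f x = sum of x ^ k / (k!) ^ 2] taken at [x = (u / 2) ^ 2]
    ([BesselI0_PSeries]), so [r = 5 * f' 25 / f 25] ([bessel_ratio0]).  The
    [k]-th term of [f' x] is the [k]-th term of [f x] divided by [k + 1]; hence
    [c * f 25 - 5 * f' 25] is the sum of [(c - 5 / (k + 1)) * 25 ^ k / (k!) ^ 2].
    For [c = 0.9487] all terms with [k >= 5] are positive, so a single positive
    partial sum settles the sign without any estimate of the tail, and the twelve
    terms [k <= 11] suffice ([I0_series_ratio_25]). *)

(** * The Gamma function at positive integers *)

(** The antiderivative of [t ^ k * exp (- t)] that tends to [0] at infinity, as
    produced by repeated integration by parts. *)
Fixpoint gamma_primitive (k : nat) (t : R) : R :=
  match k with
  | O => - exp (- t)
  | S k' => - (t ^ S k' * exp (- t)) + INR (S k') * gamma_primitive k' t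
  end.

Lemma is_derive_gamma_primitive (k : nat) (t : R) :
  is_derive (gamma_primitive k) t (t ^ k * exp (- t)).
Proof.
induction k as [|k IH].
- simpl; auto_derive; trivial; ring.
- change (gamma_primitive (S k)) with
    (fun t => - (t ^ S k * exp (- t)) + INR (S k) * gamma_primitive k t).
  replace (t ^ S k * exp (- t)) with
    ((- (INR (S k) * t ^ k * exp (- t)) + t ^ S k * exp (- t))
      + INR (S k) * (t ^ k * exp (- t))) by ring.
  apply (is_derive_plus (fun t => - (t ^ S k * exp (- t)))).
  + auto_derive; trivial.
    change (pred (S k)) with k.
    change (match k with O => 1 | S _ => INR k + 1 end) with (INR (S k)).
    simpl (t ^ S k); ring.
  + now apply (is_derive_scal (gamma_primitive k)).
Qed.

Lemma gamma_primitive_0 (k : nat) : gamma_primitive k 0 = - INR (fact k).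
Proof.
induction k as [|k IH].
- simpl; rewrite Ropp_0, exp_0; ring.
- change (gamma_primitive (S k) 0) with
    (- (0 ^ S k * exp (- 0)) + INR (S k) * gamma_primitive k 0).
  rewrite IH, fact_simpl, mult_INR; simpl (0 ^ S k); ring.
Qed.

(** One term of the exponential series, [t ^ (k + 1) / (k + 1)! <= exp t], bounds
    the function by a constant multiple of [1 / t]. *)
Lemma pow_mult_exp_opp_lim (k : nat) :
  is_lim (fun t => t ^ k * exp (- t)) p_infty 0.
Proof.
apply (is_lim_le_le_loc (fun _ => 0) (fun t => INR (fact (S k)) * / t)).
- exists 0; intros t Ht.
  assert (Hexp : t ^ S k / INR (fact (S k)) <= exp t).
  { eapply Rle_trans; [|apply (exp_ge_taylor t (S k)); lra].
    simpl sum_f_R0.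
    assert (0 <= sum_f_R0 (fun i => t ^ i / INR (fact i)) k).
    { apply cond_pos_sum; intros i.
      apply Rmult_le_pos; [apply pow_le; lra|].
      apply Rlt_le, Rinv_0_lt_compat, INR_fact_lt_0. }
    change (t * t ^ k) with (t ^ S k).
    change (fact k + k * fact k)%nat with (fact (S k)); lra. }
  pose proof (INR_fact_lt_0 (S k)) as Hfact.
  pose proof (exp_pos t) as He.
  split.
  + apply Rmult_le_pos; [apply pow_le; lra|apply Rlt_le, exp_pos].
  + rewrite exp_Ropp.
    apply (Rmult_le_reg_r (exp t * t / INR (fact (S k)))).
    { apply Rdiv_lt_0_compat; [nra|exact Hfact]. }
    replace (t ^ k * / exp t * (exp t * t / INR (fact (S k))))
      with (t ^ S k / INR (fact (S k))) by (simpl (t ^ S k); field; lra).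
    replace (INR (fact (S k)) * / t * (exp t * t / INR (fact (S k))))
      with (exp t) by (field; lra).
    exact Hexp.
- apply is_lim_const.
- replace (Finite 0) with (Rbar_mult (INR (fact (S k))) 0)
    by (simpl; f_equal; ring).
  apply is_lim_scal_l.
  replace (Finite 0) with (Rbar_inv p_infty) by reflexivity.
  apply is_lim_inv; [apply is_lim_id|discriminate].
Qed.

Lemma gamma_primitive_lim (k : nat) : is_lim (gamma_primitive k) p_infty 0.
Proof.
induction k as [|k IH].
- apply (is_lim_ext (fun t => - (t ^ 0 * exp (- t)))).
  { intros t; simpl; ring. }
  replace (Finite 0) with (Rbar_opp 0) by (simpl; f_equal; ring).
  apply is_lim_opp, pow_mult_exp_opp_lim.
- apply (is_lim_plus (fun t => - (t ^ S k * exp (- t)))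
           (fun t => INR (S k) * gamma_primitive k t) p_infty
           (Rbar_opp 0) (Rbar_mult (INR (S k)) 0)).
  + apply is_lim_opp, pow_mult_exp_opp_lim.
  + apply is_lim_scal_l, IH.
  + unfold is_Rbar_plus; simpl; do 2 f_equal; ring.
Qed.

Theorem Gamma_INR_succ (k : nat) : Gamma (INR k + 1) = INR (fact k).
Proof.
assert (HD : forall t, Derive (gamma_primitive k) t = t ^ k * exp (- t)).
{ intros t; apply is_derive_unique, is_derive_gamma_primitive. }
unfold Gamma; apply is_RInt_gen_unique.
apply (is_RInt_gen_ext (Derive (gamma_primitive k))).
- apply (Filter_prod _ _ _ (fun a => 0 < a) (fun b => 0 < b)).
  + now exists (mkposreal 1 Rlt_0_1).
  + now exists 0.
  + intros a b Ha Hb t [Ht _]; simpl in Ht.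
    assert (0 < t) by (revert Ht; unfold Rmin; destruct (Rle_dec a b); lra).
    rewrite HD; f_equal.
    replace (INR k + 1 - 1) with (INR k) by ring.
    now rewrite Rpower_pow.
- replace (INR (fact k)) with (0 - gamma_primitive k 0)
    by (rewrite gamma_primitive_0; ring).
  apply is_RInt_gen_Derive.
  + apply filter_forall; intros _ t _.
    eexists; apply is_derive_gamma_primitive.
  + apply filter_forall; intros _ t _.
    apply (continuous_ext (fun t => t ^ k * exp (- t))).
    { intros s; now rewrite HD. }
    apply (ex_derive_continuous (fun t => t ^ k * exp (- t))).
    auto_derive; trivial.
  + apply (filterlim_filter_le_1 (gamma_primitive k)
             (filter_le_within (F := locally 0) (fun t => 0 < t))).
    apply (ex_derive_continuous (gamma_primitive k)).
    eexists; apply is_derive_gamma_primitive.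
  + exact (gamma_primitive_lim k).
Qed.

(** * The power series of [I_0] *)

Definition I0_coef (k : nat) : R := / INR (fact k) ^ 2.

Lemma I0_coef_pos (k : nat) : 0 < I0_coef k.
Proof. apply Rinv_0_lt_compat, pow_lt, INR_fact_lt_0. Qed.

Lemma I0_coef_succ (k : nat) : I0_coef (S k) = I0_coef k / INR (S k) ^ 2.
Proof.
unfold I0_coef; rewrite fact_simpl, mult_INR.
field; split; [apply INR_fact_neq_0|now apply not_0_INR].
Qed.

Lemma PS_derive_I0_coef (k : nat) :
  PS_derive I0_coef k = I0_coef k / INR (S k).
Proof.
unfold PS_derive; rewrite I0_coef_succ; field; now apply not_0_INR.
Qed.

Lemma I0_coef_radius : CV_radius I0_coef = p_infty.
Proof.
apply CV_radius_infinite_DAlembert.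
- intros k; apply Rgt_not_eq, I0_coef_pos.
- apply (is_lim_seq_ext (fun k => / INR (S k) * / INR (S k))).
  { intros k; rewrite I0_coef_succ.
    pose proof (I0_coef_pos k); pose proof (lt_0_INR (S k) (Nat.lt_0_succ k)).
    rewrite Rabs_pos_eq.
    - field; lra.
    - apply Rlt_le; repeat apply Rdiv_lt_0_compat; try apply pow_lt; lra. }
  assert (Hinv : is_lim_seq (fun k => / INR (S k)) 0).
  { apply (is_lim_seq_inv (fun k => INR (S k)) p_infty).
    - apply (is_lim_seq_incr_1 INR), is_lim_seq_INR.
    - discriminate. }
  replace (Finite 0) with (Finite (0 * 0)) by (f_equal; ring).
  now apply is_lim_seq_mult'.
Qed.

Lemma ex_series_I0 (x : R) : ex_series (fun k => I0_coef k * x ^ k).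
Proof.
apply ex_series_Rabs, CV_disk_inside; now rewrite I0_coef_radius.
Qed.

Lemma ex_series_derive_I0 (x : R) :
  ex_series (fun k => PS_derive I0_coef k * x ^ k).
Proof.
apply ex_series_Rabs, CV_disk_inside.
now rewrite CV_radius_derive, I0_coef_radius.
Qed.

Lemma BesselI0_PSeries (u : R) :
  0 < u -> BesselI 0 u = PSeries I0_coef ((u / 2) ^ 2).
Proof.
intros Hu; apply Series_ext; intros k.
replace (2 * INR k + 0) with (INR (2 * k)) by (rewrite mult_INR; simpl; ring).
replace (INR k + 0 + 1) with (INR k + 1) by ring.
rewrite Rpower_pow, Gamma_INR_succ, pow_mult by lra.
unfold I0_coef; field; apply INR_fact_neq_0.
Qed.

Lemma Derive_BesselI0 (u : R) :
  0 < u ->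
  Derive (BesselI 0) u = u / 2 * PSeries (PS_derive I0_coef) ((u / 2) ^ 2).
Proof.
intros Hu.
rewrite (Derive_ext_loc _ (fun v => PSeries I0_coef ((v / 2) ^ 2))).
- apply is_derive_unique.
  apply (is_derive_comp (PSeries I0_coef) (fun v => (v / 2) ^ 2)).
  + apply is_derive_PSeries; now rewrite I0_coef_radius.
  + auto_derive; trivial; field.
- apply (filter_imp (fun v => 0 < v)); [exact BesselI0_PSeries|].
  now apply open_gt.
Qed.

Lemma bessel_ratio0 (u : R) :
  0 < u ->
  bessel_ratio 0 u =
    u / 2 * PSeries (PS_derive I0_coef) ((u / 2) ^ 2)
      / PSeries I0_coef ((u / 2) ^ 2).
Proof.
intros Hu; unfold bessel_ratio.
now rewrite Derive_BesselI0, BesselI0_PSeries.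
Qed.

(** * Numerical bounds at 25 *)

Lemma Series_ge_partial_sum (a : nat -> R) (n : nat) :
  ex_series a -> (forall k, (n < k)%nat -> 0 <= a k) ->
  sum_f_R0 a n <= Series a.
Proof.
intros Ha Hpos.
rewrite (Series_incr_n a (S n) (Nat.lt_0_succ n) Ha); simpl pred.
assert (Htail : Series (fun k => 0 * a (S n + k)%nat)
                <= Series (fun k => a (S n + k)%nat)).
{ apply Series_le.
  - intros k; assert (0 <= a (S n + k)%nat) by (apply Hpos; lia); lra.
  - now apply ex_series_incr_n. }
rewrite Series_scal_l in Htail; lra.
Qed.

Lemma I0_series_pos (x : R) : 0 <= x -> 0 < PSeries I0_coef x.
Proof.
intros Hx.
apply Rlt_le_trans with (sum_f_R0 (fun k => I0_coef k * x ^ k) 0).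
- simpl; rewrite Rmult_1_r; apply I0_coef_pos.
- apply (Series_ge_partial_sum (fun k => I0_coef k * x ^ k)).
  + apply ex_series_I0.
  + intros k _; apply Rmult_le_pos; [apply Rlt_le, I0_coef_pos|now apply pow_le].
Qed.

Lemma derive_I0_series_nonneg (x : R) :
  0 <= x -> 0 <= PSeries (PS_derive I0_coef) x.
Proof.
intros Hx.
assert (Hterm : forall k, 0 <= PS_derive I0_coef k * x ^ k).
{ intros k; apply Rmult_le_pos; [|now apply pow_le].
  rewrite PS_derive_I0_coef; apply Rlt_le, Rdiv_lt_0_compat.
  - apply I0_coef_pos.
  - apply lt_0_INR; lia. }
apply Rle_trans with (1 := Hterm 0%nat).
apply (Series_ge_partial_sum (fun k => PS_derive I0_coef k * x ^ k) 0).
- apply ex_series_derive_I0.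
- intros k _; apply Hterm.
Qed.

(** The two sides are close to [2671] and differ by about [0.28].  In the series of
    the difference, the terms with index above [11] are positive; the partial sum
    up to [11], the first positive one, is about [0.109]. *)
Lemma I0_series_ratio_25 :
  5 * PSeries (PS_derive I0_coef) 25 <= 9487 / 10000 * PSeries I0_coef 25.
Proof.
set (b := fun k => I0_coef k * 25 ^ k).
set (d := fun k => 9487 / 10000 * b k - 5 * (PS_derive I0_coef k * 25 ^ k)).
assert (Hb : forall k, 0 < b k).
{ intros k; apply Rmult_lt_0_compat; [apply I0_coef_pos|apply pow_lt; lra]. }
assert (Hd : forall k, d k = (9487 / 10000 - 5 / INR (S k)) * b k).
{ intros k; unfold d, b; rewrite PS_derive_I0_coef.
  field; now apply not_0_INR. }
assert (Hb0 : b 0%nat = 1) by (unfold b, I0_coef; simpl; field).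
assert (HbS : forall k, b (S k) = 25 / INR (S k) ^ 2 * b k).
{ intros k; unfold b; rewrite I0_coef_succ; simpl (25 ^ S k).
  field; now apply not_0_INR. }
assert (Hexb : ex_series (fun k => 9487 / 10000 * b k)).
{ apply (ex_series_scal_l (9487 / 10000) b), ex_series_I0. }
assert (Hexb' : ex_series (fun k => 5 * (PS_derive I0_coef k * 25 ^ k))).
{ apply (ex_series_scal_l 5 (fun k => PS_derive I0_coef k * 25 ^ k)).
  apply ex_series_derive_I0. }
assert (Hsum : Series d = 9487 / 10000 * PSeries I0_coef 25
                          - 5 * PSeries (PS_derive I0_coef) 25).
{ unfold d; rewrite Series_minus by assumption.
  now rewrite !Series_scal_l. }
assert (Hpart : sum_f_R0 d 11 <= Series d).
{ apply Series_ge_partial_sum.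
  - now apply (ex_series_minus (fun k => 9487 / 10000 * b k)).
  - intros k Hk; rewrite Hd.
    apply Rmult_le_pos; [|apply Rlt_le, Hb].
    assert (HSk : 12 <= INR (S k)).
    { replace 12 with (INR 12) by (simpl; ring); apply le_INR; lia. }
    assert (5 / INR (S k) <= 5 / 12).
    { apply Rmult_le_compat_l; [lra|apply Rinv_le_contravar; lra]. }
    lra. }
assert (0 < sum_f_R0 d 11).
{ cbn [sum_f_R0]; rewrite !Hd, !HbS, Hb0, !INR_IZR_INZ; cbn -[Rlt]; lra. }
lra.
Qed.

Theorem mainTheorem6 :
  ~ (forall nu u : R, 0 <= nu -> 0 < u ->
       1 + (nu ^ 2 - 1 / 2) / u ^ 2 - bessel_ratio nu u / u
         - bessel_ratio nu u ^ 2 < 0)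
  /\ ~ (1 + (0 ^ 2 - 1 / 2) / 10 ^ 2 - bessel_ratio 0 10 / 10
         - bessel_ratio 0 10 ^ 2 < 0).
Proof.
assert (Hfail : ~ (1 + (0 ^ 2 - 1 / 2) / 10 ^ 2 - bessel_ratio 0 10 / 10
                     - bessel_ratio 0 10 ^ 2 < 0)).
{ assert (Hr : 0 <= bessel_ratio 0 10 <= 9487 / 10000).
  { rewrite bessel_ratio0 by lra.
    replace ((10 / 2) ^ 2) with 25 by field.
    replace (10 / 2) with 5 by field.
    assert (Hf : 0 < PSeries I0_coef 25) by (apply I0_series_pos; lra).
    assert (Hf' : 0 <= PSeries (PS_derive I0_coef) 25)
      by (apply derive_I0_series_nonneg; lra).
    split.
    - apply Rdiv_le_0_compat; lra.
    - apply Rle_div_l; [exact Hf|exact I0_series_ratio_25]. }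
  nra. }
split; [|exact Hfail].
intros H; apply Hfail, (H 0 10); lra.
Qed.
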